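(* Let $\cong$ be a congruence on LTSs such that $L\doteq L'$ implies $L\cong L'$, $\cong$ preserves $\mathit{Sf}$ and $\mathit{Inf}$, and $D\cong B$. Then $\cong$ is the equivalence induced by $\Sigma$, $\mathit{Tr}$, $\mathit{Sf}$ and $\mathit{Inf}$.
   Context: An LTS is a tuple $L=(S,\Sigma,\Delta,\hat s)$ with states $S$, alphabet $\Sigma$ (possibly infinite), $\tau\notin\Sigma$ a reserved invisible action, transitions $\Delta\subseteq S\times(\Sigma\cup\{\tau\})\times S$, initial state $\hat s$; $\Sigma(L)$ denotes the alphabet. Operators: action prefix $a.L$ ($a\neq\tau$): new initial state $\hat s'$, alphabet $\Sigma\cup\{a\}$, transitions $\Delta\cup\{(\hat s',a,\hat s)\}$. Hiding $L\setminus A$: alphabet $\Sigma\setminus A$, each transition labelled by an element of $A$ relabelled $\tau$, otherwise unchanged. Relational renaming $L\Phi$ ($\Phi$ a set of pairs, $\tau$ not in its domain $\mathcal D(\Phi)$ or range; $\Phi(a,b)$ means $(a,b)\in\Phi$ or $a=b\notin\mathcal D(\Phi)$): alphabet $\{b\mid\exists a\in\Sigma:\Phi(a,b)\}$, transitions $\{(s,b,s')\mid\exists a:(s,a,s')\in\Delta\wedge\Phi(a,b)\}$, same states and initial state. Parallel composition $L_1\|L_2$: states $S_1\times S_2$, alphabet $\Sigma_1\cup\Sigma_2$, initial $(\hat s_1,\hat s_2)$; actions in $\Sigma_1\cap\Sigma_2$ are taken jointly by both components, all other actions (including $\tau$) by one component while the other stays put. A congruence is an equivalence $\cong$ with $L\cong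 L'\Rightarrow a.L\cong a.L',\ L\setminus A\cong L'\setminus A,\ L\Phi\cong L'\Phi,\ L\|L''\cong L'\|L'',\ L''\|L\cong L''\|L'$. For $\sigma=a_1\cdots a_n\in\Sigma^*$, $s\stackrel{\sigma}{\Rightarrow}s'$ means a finite path from $s$ to $s'$ whose non-$\tau$ labels are exactly $a_1,\dots,a_n$ in order; $\hat s\stackrel{\xi}{\Rightarrow}$ for $\xi\in\Sigma^\omega$ means an infinite path from $\hat s$ whose non-$\tau$ label sequence is $\xi$; $s\stackrel{\tau^\omega}{\to}$ means an infinite path of $\tau$-transitions from $s$. Define $\mathit{Tr}(L)=\{\sigma\in\Sigma^*\mid\exists s:\hat s\stackrel\sigma\Rightarrow s\}$, $\mathit{Div}(L)=\{\sigma\in\Sigma^*\mid\exists s:\hat s\stackrel\sigma\Rightarrow s\wedge s\stackrel{\tau^\omega}\to\}$, $\mathit{Inf}(L)=\{\xi\in\Sigma^\omega\mid\hat s\stackrel\xi\Rightarrow\}$, $\mathit{Sf}(L)=\{(\sigma,A)\in\Sigma^*\times2^\Sigma\mid\exists s:\hat s\stackrel\sigma\Rightarrow s\wedge\forall a\in A\cup\{\tau\}\,\forall s':(s,a,s')\notin\Delta\}$. $L\doteq L'$ (CFFD-equivalence) iff $\Sigma,\mathit{Sf},\mathit{Div},\mathit{Inf}$ all agree on $L$ and $L'$. An equivalence preserves $X$ if $L\cong L'\Rightarrow X(L)=X(L')$; the equivalence induced by $\Sigma,X_1,\dots,X_k$ relates $L,L'$ iff all these functions agree on them. $D$ is the one-state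 LTS with empty alphabet and no transitions; $B$ is the LTS with empty alphabet, states $s_0$ (initial) and $s_1$, and transitions $(s_0,\tau,s_0)$, $(s_0,\tau,s_1)$. *)

(* Defs.v *)
From mathcomp Require Import all_boot.
From mathcomp Require Import boolp classical_sets cardinality.

Set Implicit Arguments.
Unset Strict Implicit.
Unset Printing Implicit Defensive.

Local Open Scope classical_set_scope.

(* All alphabets are subsets of one type [Act] of visible actions.  A
   transition label has type [option Act]: [None] is the invisible action tau
   and [Some a] is the visible action [a], so tau is in no alphabet. *)
Record lts (Act : Type) := LTS {
  state : Type;
  alphabet : set Act;
  trans : state -> option Act -> state -> Prop;
  init : state;
  trans_alphabet : forall s a s', trans s (Some a) s' -> alphabet a
}.

Arguments LTS {Act state alphabet trans} init trans_alphabet.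
Arguments alphabet {Act} l _.
Arguments trans {Act} l _ _ _.
Arguments init {Act} l.

Section Operators.
Variable Act : Type.
Implicit Types (L : lts Act) (a : Act) (A : set Act) (x y : option Act).

Definition vis A : set (option Act) := Some @` A.

Lemma visE A a : vis A (Some a) <-> A a.
Proof. by split=> [[b Ab [<-]]|Aa] //; exists a. Qed.

(* The states of a.L are [option (state L)]; [None] is the new initial state. *)
Definition prefix_trans a L (s : option (state L)) x (s' : option (state L)) :=
  [/\ s = None, x = Some a & s' = Some (init L)] \/
  exists t t', [/\ s = Some t, s' = Some t' & trans L t x t'].

Lemma prefix_alphabet a L s b s' :
  @prefix_trans a L s (Some b) s' -> (alphabet L `|` [set a]) b.
Proof.
case=> [[_ [->] _]|[t [t' [_ _ Lt]]]]; first by right.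
by left; exact: trans_alphabet Lt.
Qed.

Definition prefix a L : lts Act := LTS None (@prefix_alphabet a L).

Definition hide_trans L A (s : state L) x (s' : state L) :=
  (x = None /\ exists2 a, A a & trans L s (Some a) s') \/
  (~ vis A x /\ trans L s x s').

Lemma hide_alphabet L A s b s' :
  @hide_trans L A s (Some b) s' -> (alphabet L `\` A) b.
Proof.
case=> [[]//|[nAb Lt]]; split; first exact: trans_alphabet Lt.
by move=> Ab; apply: nAb; apply/visE.
Qed.

Definition hide L A : lts Act := LTS (init L) (@hide_alphabet L A).

(* [Phi.`1] is the domain of [Phi].  Labels outside it, tau among them, are
   kept. *)
Definition rename_label (Phi : set (Act * Act)) x y :=
  (exists a b, [/\ x = Some a, y = Some b & Phi (a, b)]) \/
  (x = y /\ ~ vis Phi.`1 x).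

Definition rename_trans L Phi (s : state L) y (s' : state L) :=
  exists2 x, trans L s x s' & rename_label Phi x y.

Lemma rename_alphabet L Phi s b s' : @rename_trans L Phi s (Some b) s' ->
  [set c | exists2 a, alphabet L a & rename_label Phi (Some a) (Some c)] b.
Proof.
case=> -[a|] Lt Pab; first by exists a => //; exact: trans_alphabet Lt.
by case: Pab => [[a [c []]]|[]].
Qed.

Definition rename L Phi : lts Act := LTS (init L) (@rename_alphabet L Phi).

Definition par_trans L1 L2 (s : state L1 * state L2) x
    (s' : state L1 * state L2) :=
  [\/ [/\ vis (alphabet L1 `&` alphabet L2) x,
          trans L1 s.1 x s'.1 & trans L2 s.2 x s'.2],
      [/\ ~ vis (alphabet L1 `&` alphabet L2) x,
          trans L1 s.1 x s'.1 & s'.2 = s.2] |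
      [/\ ~ vis (alphabet L1 `&` alphabet L2) x,
          s'.1 = s.1 & trans L2 s.2 x s'.2]].

Lemma par_alphabet L1 L2 s b s' :
  @par_trans L1 L2 s (Some b) s' -> (alphabet L1 `|` alphabet L2) b.
Proof.
case=> [[_ Lt _]|[_ Lt _]|[_ _ Lt]].
- by left; exact: trans_alphabet Lt.
- by left; exact: trans_alphabet Lt.
- by right; exact: trans_alphabet Lt.
Qed.

Definition par L1 L2 : lts Act :=
  LTS (init L1, init L2) (@par_alphabet L1 L2).

Definition D : lts Act :=
  @LTS Act unit set0 (fun _ _ _ => False) tt (fun _ _ _ => @id False).

(* s0 is [false], s1 is [true]. *)
Definition B_trans (s : bool) x (s' : bool) :=
  (s, x, s') = (false, None, false) \/ (s, x, s') = (false, None, true).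

Lemma B_alphabet s a s' : B_trans s (Some a) s' -> (set0 : set Act) a.
Proof. by case. Qed.

Definition B : lts Act := LTS false B_alphabet.

End Operators.

Section Semantics.
Variable Act : Type.
Implicit Types (L : lts Act) (sigma : seq Act) (xi : nat -> Act).

Fixpoint fin_path L (s : state L) (w : seq (option Act)) (s' : state L) : Prop :=
  if w is x :: w' then exists2 t, trans L s x t & fin_path t w' s' else s = s'.

Definition inf_path L (s : state L) (w : nat -> option Act) :=
  exists2 p : nat -> state L,
    p 0 = s & forall n, trans L (p n) (w n) (p n.+1).

(* [pmap id w] deletes the tau's from [w]. *)
Definition weak L (s : state L) sigma (s' : state L) :=
  exists2 w, fin_path s w s' & pmap id w = sigma.

(* [f] enumerates in increasing order the positions of the labels that are
   not tau. *)
Definition visible_labels (w : nat -> option Act) xi :=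
  exists f : nat -> nat,
    [/\ forall m n, m < n -> f m < f n,
        forall n, w (f n) = Some (xi n) &
        forall k, w k <> None -> exists n, k = f n].

Definition weak_inf L (s : state L) xi :=
  exists2 w, inf_path s w & visible_labels w xi.

Definition diverges L (s : state L) := inf_path s (fun=> None).

(* By [trans_alphabet], the words in Tr, Div, Inf and Sf are automatically
   over [alphabet L]. *)
Definition Tr L : set (seq Act) :=
  [set sigma | exists s, weak (init L) sigma s].

Definition Div L : set (seq Act) :=
  [set sigma | exists2 s, weak (init L) sigma s & diverges s].

Definition Inf L : set (nat -> Act) := [set xi | weak_inf (init L) xi].

Definition Sf L : set (seq Act * set Act) :=
  [set sA | sA.2 `<=` alphabet L /\
     exists2 s, weak (init L) sA.1 s &
       forall x, (vis sA.2 `|` [set None]) x -> forall s', ~ trans L s x s'].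

Definition cffd_equiv L L' :=
  [/\ alphabet L = alphabet L', Sf L = Sf L', Div L = Div L' &
      Inf L = Inf L'].

End Semantics.

Record congruence (Act : Type) (R : lts Act -> lts Act -> Prop) : Prop := {
  cong_refl : forall L, R L L;
  cong_sym : forall L L', R L L' -> R L' L;
  cong_trans : forall L L' L'', R L L' -> R L' L'' -> R L L'';
  cong_prefix : forall a L L', R L L' -> R (prefix a L) (prefix a L');
  cong_hide : forall A L L', R L L' -> R (hide L A) (hide L' A);
  cong_rename : forall Phi L L', R L L' -> R (rename L Phi) (rename L' Phi);
  cong_parl : forall L L' L'', R L L' -> R (par L L'') (par L' L'');
  cong_parr : forall L L' L'', R L L' -> R (par L'' L) (par L'' L')
}.

Definition preserves (Act V : Type) (R : lts Act -> lts Act -> Prop)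
    (X : lts Act -> V) :=
  forall L L', R L L' -> X L = X L'.

(* Main.v *)
Require Import Defs.
From Stdlib Require List.
From mathcomp Require Import all_boot.
From mathcomp Require Import boolp classical_sets cardinality.

(** Since [D] only idles, [L || D] is CFFD-equivalent to [L], so [D ~ B] gives
  [L ~ L || B].  Composing with [B] keeps the alphabet, Tr, Sf and Inf but makes
  every trace divergent.  Hence, if these four agree on [L] and [L'], then
  [L || B] and [L' || B] are CFFD-equivalent, and [L ~ L'].
  Conversely, Inf determines the rest through contexts.  If [a] is in the
  alphabet of [L] but not of [L'], then composing with a loop on [a] gives
  [L'] the infinite trace a^omega, which [L] cannot acquire.  For a word
  [sigma] that avoids some action [b], block and hide [b] in [L] and compose
  with a loop on [b]: then sigma b^omega is an infinite trace of the result iff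
  [sigma] is a trace of [L].  Such a [b] exists as there are infinitely many
  actions. *)

Set Implicit Arguments.
Unset Strict Implicit.
Unset Printing Implicit Defensive.

Local Open Scope classical_set_scope.

(** * Infinite words and infinite runs *)

Section InfiniteWords.
Variable Act : Type.
Implicit Types (L : lts Act) (w : nat -> option Act) (xi : nat -> Act).

Definition scons (T : Type) (x : T) (u : nat -> T) (k : nat) : T :=
  if k is k'.+1 then u k' else x.

Definition cat_inf (sigma : seq Act) xi : nat -> Act :=
  foldr (@scons Act) xi sigma.

Lemma mkseq_cat_inf sigma xi : mkseq (cat_inf sigma xi) (size sigma) = sigma.
Proof.
elim: sigma => [//|a sigma IH] /=.
by rewrite /mkseq /= -[1]addn0 iotaDl -map_comp; congr cons; exact: IH.
Qed.

Lemma weak_inf_cat L (s t : state L) sigma xi :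
  weak s sigma t -> weak_inf t xi -> weak_inf s (cat_inf sigma xi).
Proof.
case=> w + <-; elim: w s => [|x w IH] s /=; first by move=> ->.
case=> u sxu uwt txi; have [v [p p0 pv] [f [fmono fxi fvis]]] := IH _ uwt txi.
exists (scons x v).
  by exists (scons s p) => // -[|n] /=; rewrite ?p0.
(* A leading tau only shifts the visible positions by one; a leading visible label also adds
   position 0. *)
case: x sxu => [a|] _ /=.
- exists (scons 0 (S \o f)); split.
  + by case=> [|m] [|n] //=; rewrite !ltnS; exact: fmono.
  + by case=> [|n] //=.
  + by case=> [|k] /=; [exists 0 | move/fvis => [n ->]; exists n.+1].
- exists (S \o f); split=> /=.
  + by move=> m n /fmono.
  + by [].
  + by case=> [|k] //= /fvis [n ->]; exists n.
Qed.

(** Cutting [w] just before [f n], where visible label number n (counted from 0) sits, leaves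
    exactly the n earlier visible labels. *)
Lemma visible_labels_prefix w xi : visible_labels w xi ->
  forall n, exists k, pmap id (mkseq w k) = mkseq xi n.
Proof.
case=> f [fmono fxi fvis] N; exists (f N).
have flt : {mono f : m n / m < n} := leqW_mono (leq_mono fmono).
(* For an arbitrary cut [k], the number [n] of visible labels before it is pinned down by its order
   relation to [f], which makes induction on [k] possible. *)
suff H k : exists2 n, pmap id (mkseq w k) = mkseq xi n &
    forall m, (m < n) = (f m < k).
  have [n -> nP] := H (f N); congr mkseq.
  apply/eqP; rewrite eqn_leq [n <= N]leqNgt [N <= n]leqNgt.
  by rewrite nP ltnn /= -[n < N]flt -nP ltnn.
elim: k => [|k [n IH nP]]; first by exists 0.
rewrite mkseqS -cats1 pmap_cat IH /=.
case wk: (w k) => [a|] /=.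
- have [m kfm] : exists m, k = f m by apply: fvis; rewrite wk.
  have mn : n = m.
    apply/eqP; rewrite eqn_leq [n <= m]leqNgt [m <= n]leqNgt.
    by rewrite nP kfm ltnn /= -[n < m]flt -kfm -nP ltnn.
  exists n.+1.
    by move: wk; rewrite kfm fxi mkseqS -cats1 mn => -[->].
  by move=> i; rewrite kfm ltnS [RHS]ltnS leqNgt -flt -leqNgt mn.
- exists n; first by rewrite cats0.
  move=> m; rewrite nP ltnS [RHS]leq_eqVlt.
  by case: eqP => // fmk; move: (fxi m); rewrite fmk wk.
Qed.

Lemma inf_path_prefix L (s : state L) w k :
  inf_path s w -> exists t, fin_path s (mkseq w k) t.
Proof.
case=> p <- pw; exists (p k).
elim: k (p) (w) pw => [//|k IH] q v qv; exists (q 1); first exact: qv.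
have := IH (fun n => q n.+1) (fun n => v n.+1) (fun n => qv n.+1).
by rewrite /mkseq -[1]addn0 iotaDl -map_comp.
Qed.

Lemma weak_inf_prefix L (s : state L) sigma xi :
  weak_inf s (cat_inf sigma xi) -> exists t, weak s sigma t.
Proof.
case=> w sw /visible_labels_prefix /(_ (size sigma)) [k].
rewrite mkseq_cat_inf => wk; have [t st] := inf_path_prefix k sw.
by exists t; exists (mkseq w k).
Qed.

(** [g] repeatedly takes the least element of [P] strictly beyond the previous value; by minimality
    no element is skipped. *)
Lemma enum_infinite (P : nat -> Prop) :
  (forall n, exists2 k, n <= k & P k) ->
  exists g : nat -> nat,
    [/\ forall m n, m < n -> g m < g n, forall n, P (g n) &
        forall k, P k -> exists n, k = g n].
Proof.
move=> Pinf.
have next n : exists m, [/\ n <= m, P m & forall k, n <= k -> P k -> m <= k].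
  have ex : exists k, `[< n <= k /\ P k >].
    by have [k] := Pinf n; exists k; apply/asboolP.
  case: (ex_minnP ex) => m /asboolP [nm Pm] mmin.
  by exists m; split=> // k nk Pk; apply: mmin; apply/asboolP.
have [h hP] := choice next.
pose g n := iter n (h \o S) (h 0).
have gS n : g n < g n.+1 by have [] := hP (g n).+1.
have gmono m n : m < n -> g m < g n.
  elim: n => // n IH; rewrite ltnS leq_eqVlt => /orP [/eqP -> //|/IH mn].
  exact: ltn_trans mn (gS n).
exists g; split=> // [[|n]|k Pk]; first by have [] := hP 0.
  by have [] := hP (g n).+1.
have glarge n : n <= g n.
  by elim: n => // n IH; exact: leq_ltn_trans IH (gS n).
have : k <= g k by exact: glarge.
(* Descending to the least index [n] with [k <= g n] gives [k = g n]. *)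
elim: {2}k => [|n IH] kn.
  exists 0; apply/eqP; rewrite eqn_leq kn /=.
  by have [_ _] := hP 0; exact.
case: (leqP k (g n)) => [/IH //|nk].
exists n.+1; apply/eqP; rewrite eqn_leq kn /=.
by have [_ _] := hP (g n).+1; exact.
Qed.

(* Deleting the stutters of a run leaves a run, which is still infinite since
   it keeps the visible steps. *)
Lemma weak_inf_destutter L (q : nat -> state L) w xi :
  (forall k, trans L (q k) (w k) (q k.+1) \/ w k = None /\ q k.+1 = q k) ->
  visible_labels w xi -> weak_inf (q 0) xi.
Proof.
move=> qw [f [fmono fxi fvis]].
pose P k := trans L (q k) (w k) (q k.+1).
have Pf n : P (f n) by case: (qw (f n)) => // -[]; rewrite fxi.
have flarge n : n <= f n.
  by elim: n => // n IH; apply: leq_ltn_trans IH _; exact: fmono.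
have [g [gmono gP gsurj]] : exists g : nat -> nat,
    [/\ forall m n, m < n -> g m < g n, forall n, P (g n) &
        forall k, P k -> exists n, k = g n].
  by apply: enum_infinite => n; exists (f n).
have glt : {mono g : m n / m < n} := leqW_mono (leq_mono gmono).
(* [q] does not move at positions outside [P], so consecutive kept steps still fit together. *)
have stutter i j : i <= j -> (forall k, i <= k -> k < j -> ~ P k) -> q j = q i.
  elim: j => [|j IH]; first by rewrite leqn0 => /eqP ->.
  rewrite leq_eqVlt => /orP [/eqP -> //|]; rewrite ltnS => ij notP.
  rewrite -(IH ij); last by move=> k ik kj; apply: notP => //; exact: ltnW.
  by case: (qw j) => [/(notP _ ij (ltnSn j))//|[]].
have q0 : q (g 0) = q 0.
  apply: stutter => // k _ kg0 /gsurj [n kn].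
  by move: kg0; rewrite kn glt ltn0.
have qS n : q (g n.+1) = q (g n).+1.
  apply: stutter; first exact: gmono.
  move=> k nk kn /gsurj [m km]; move: nk kn.
  by rewrite km !glt => nm; rewrite ltnS leqNgt nm.
(* [f' n] is the index in the enumeration [g] of the visible position [f n]. *)
have [f' f'P] := choice (fun n => gsurj _ (Pf n)).
exists (w \o g).
  by exists (q \o g) => //= n; rewrite qS; exact: gP.
exists f'; split.
- by move=> m n /fmono; rewrite !f'P glt.
- by move=> n /=; rewrite -f'P.
- move=> k /= /fvis [n gk]; exists n.
  have := f'P n; rewrite -gk => /eqP; rewrite eqn_leq => /andP.
  rewrite [g k <= _]leqNgt [g _ <= g k]leqNgt !glt -!leqNgt => /andP.
  by rewrite -eqn_leq => /eqP.
Qed.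

End InfiniteWords.

Lemma weak_cat Act (L : lts Act) (s t u : state L) sigma sigma' :
  weak s sigma t -> weak t sigma' u -> weak s (sigma ++ sigma') u.
Proof.
case=> v sv <- [v' tv' <-]; exists (v ++ v'); last by rewrite pmap_cat.
elim: v s sv => [|x v IH] s /=; first by move=> ->.
by case=> r sr /IH; exists r.
Qed.

(** * Composition with a component of empty alphabet *)

Section SilentComponent.
Variables (Act : Type) (L M : lts Act).
Hypothesis M0 : alphabet M = set0.
Implicit Types (p q : state (par L M)).

(** With no shared action there are no joint steps, and [M] alone can only perform tau. *)
Lemma par_silent_transP p x q :
  trans (par L M) p x q <->
  (trans L p.1 x q.1 /\ q.2 = p.2) \/
  [/\ x = None, q.1 = p.1 & trans M p.2 None q.2].
Proof.
have nvis y : ~ vis (alphabet L `&` alphabet M) y.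
  by rewrite M0 setI0 => -[].
split.
- case=> [[/nvis]//|[_ Lt eq2]|[_ eq1 Mt]]; first by left.
  case: x Mt => [a Mt|]; last by right.
  by have := trans_alphabet Mt; rewrite M0.
- case=> [[Lt eq2]|[-> eq1 Mt]]; first exact: Or32.
  exact: Or33.
Qed.

Lemma alphabet_par_silent : alphabet (par L M) = alphabet L.
Proof. by rewrite /= M0 setU0. Qed.

Lemma weak_par_silent p sigma q : weak p sigma q -> weak p.1 sigma q.1.
Proof.
case=> w + <-; elim: w p => [|x w IH] p /=; first by move=> ->; exists [::].
case=> r /par_silent_transP + /IH {IH} [v rv vw].
case=> [[Lt _]|[-> eq1 _]].
- exists (x :: v); first by exists r.1.
  by case: x Lt => [a|] _ /=; rewrite vw.
- by exists v => //; rewrite -eq1.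
Qed.

Lemma par_silent_weakl (s s' : state L) sigma (t : state M) :
  weak s sigma s' -> weak (L := par L M) (s, t) sigma (s', t).
Proof.
case=> w sw <-; exists w => //; elim: w s sw => [|x w IH] s /=.
  by move=> ->.
case=> r sr rs'; exists (r, t); last exact: IH.
by apply/par_silent_transP; left.
Qed.

Lemma Tr_par_silent : Tr (par L M) = Tr L.
Proof.
apply/seteqP; split=> sigma [s].
- by move/weak_par_silent; exists s.1.
- by move=> Ls; exists (s, init M); exact: par_silent_weakl.
Qed.

(** The projection of a run to [L] stutters whenever [M] moves, hence the appeal to
    [weak_inf_destutter]. Conversely, [M] may idle forever in its initial state. *)
Lemma Inf_par_silent : Inf (par L M) = Inf L.
Proof.
apply/seteqP; split=> xi [w [p p0 pw] wxi].
- rewrite /Inf /=; have -> : init L = (p 0).1 by rewrite p0.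
  apply: (@weak_inf_destutter _ L (fun k => (p k).1) w) => // k.
  by case/par_silent_transP: (pw k) => [[Lt _]|[wk eq1 _]]; [left|right].
- exists w => //; exists (fun k => (p k, init M)); first by rewrite p0.
  by move=> k; apply/par_silent_transP; left; split; first exact: pw.
Qed.

(** Once [L] is in a refusing state, [M] can move silently to [t], where it offers no tau and so
    spoils no refusal. Conversely, whatever a pair of states refuses is refused by its [L]
    component. *)
Lemma Sf_par_silent (w : seq (option Act)) (t : state M) :
    fin_path (init M) w t -> pmap id w = [::] ->
    (forall t', ~ trans M t None t') ->
  Sf (par L M) = Sf L.
Proof.
move=> wt w0 stable.
have Mpath s : weak (L := par L M) (s, init M) [::] (s, t).
  exists w => //; elim: w (init M) wt w0 => [|[//|] w IH] u /=.
    by move=> ->.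
  case=> v uv vt w0; exists (s, v); last exact: IH.
  by apply/par_silent_transP; right.
apply/seteqP; split=> -[sigma A] [/= AL [s Ls st]].
- split; first by rewrite -alphabet_par_silent.
  exists s.1; first exact: weak_par_silent Ls.
  move=> x /st nt s' Lt; apply: (nt (s', s.2)).
  by apply/par_silent_transP; left.
- split; first by rewrite /= M0 setU0.
  exists (s, t).
    rewrite -[sigma]cats0.
    exact: weak_cat (par_silent_weakl (init M) Ls) (Mpath s).
  move=> x /st nt s' /par_silent_transP [[/nt]//|[_ _]]; exact: stable.
Qed.

End SilentComponent.

Lemma cffd_par_D Act (L : lts Act) : cffd_equiv (par L (D Act)) L.
Proof.
have D0 : alphabet (D Act) = set0 by [].
split.
- exact: alphabet_par_silent.
- by apply: (@Sf_par_silent _ L _ D0 [::] tt) => // t' [].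
- apply/seteqP; split=> sigma [s Ls [p p0 pw]].
  + exists s.1; first exact: weak_par_silent Ls.
    exists (fun k => (p k).1); first by rewrite p0.
    by move=> k; have /(par_silent_transP D0) [[]|[_ _ []]] := pw k.
  + exists (s, tt); first exact: par_silent_weakl.
    exists (fun k => (p k, tt)); first by rewrite p0.
    by move=> k; apply/(par_silent_transP D0); left; split; first exact: pw.
- exact: Inf_par_silent.
Qed.

Lemma Sf_par_B Act (L : lts Act) : Sf (par L (B Act)) = Sf L.
Proof.
(* A single tau takes [B] to its deadlocked state [true]. *)
apply: (@Sf_par_silent _ L (B Act) erefl [:: None] true) => //.
  by exists true => //; right.
by move=> t' [].
Qed.

(** [B] can wait in [false] while [L] performs any trace, and then loop on tau there. *)
Lemma Div_par_B Act (L : lts Act) : Div (par L (B Act)) = Tr L.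
Proof.
have B0 : alphabet (B Act) = set0 by [].
apply/seteqP; split=> sigma [s].
- by move=> Ls _; exists s.1; exact: weak_par_silent Ls.
- move=> Ls; exists (s, false); first exact: par_silent_weakl.
  exists (fun=> (s, false)) => // _.
  by apply/(par_silent_transP B0); right; split=> //; left.
Qed.

(** * Contexts that detect actions and traces *)

Section Contexts.
Variable Act : Type.
Implicit Types (L : lts Act) (a b : Act) (sigma : seq Act).

Lemma loop_alphabet a (s : unit) c (s' : unit) :
  Some c = Some a -> [set a] c.
Proof. by case. Qed.

Definition loop a : lts Act :=
  @LTS Act unit [set a] (fun _ x _ => x = Some a) tt (@loop_alphabet a).

Definition stop a : lts Act :=
  @LTS Act unit [set a] (fun _ _ _ => False) tt (fun _ _ _ => False_ind _).

Lemma Inf_par_loop_notin L a :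
  ~ alphabet L a -> Inf (par L (loop a)) (fun=> a).
Proof.
move=> nLa; exists (fun=> Some a).
  exists (fun=> (init L, tt)) => // _; apply: Or33; split=> //.
  by move/visE => [].
by exists id; split=> // k _; exists k.
Qed.

(** As [a] is shared, [loop a] never moves alone, so every step of the run is also a step of [L]. *)
Lemma Inf_par_loop_in L a :
  alphabet L a -> Inf (par L (loop a)) (fun=> a) -> Inf L (fun=> a).
Proof.
move=> La [w [p p0 pw] wa]; exists w => //.
exists (fun k => (p k).1); first by rewrite p0.
move=> k; case: (pw k) => [[]//|[]//|[nvis _ wk]]; case: nvis.
by rewrite [w k]wk; apply/visE.
Qed.

(** [stop b] blocks the [b]-steps of [L], so that hiding turns none of them into tau. Hiding then
    serves only to remove [b] from the alphabet, which leaves the outer [loop b] free to perform [b]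
    at any time. *)
Definition probe b L : lts Act :=
  par (Defs.hide (par L (stop b)) [set b]) (loop b).

Lemma probe_transP b L (p : state (probe b L)) x q : x <> Some b ->
  trans (probe b L) p x q <-> trans L p.1.1 x q.1.1.
Proof.
move=> xb; split.
- have key : trans (Defs.hide (par L (stop b)) [set b]) p.1 x q.1 ->
      trans L p.1.1 x q.1.1.
    case=> [[_ [_ -> [[_ _ []]|[nvis Lt _]|[_ _ []]]]]|[_]].
      (* A hidden step would be a [b] taken by [L] alone, although [b] is shared with [stop b]. *)
      by case: nvis; apply/visE; split=> //; exact: trans_alphabet Lt.
    by case=> [[_ _ []]|[_]|[_ _ []]].
  by case=> [[_ /key]|[_ /key]|[_ _ /xb]].
- move=> Lt; apply: Or32; split; last by case: (q.2) (p.2) => -[].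
    case: x xb {Lt} => [c|] xb; last by case.
    by move=> /visE [_ cb]; apply: xb; rewrite cb.
  right; split; first by case=> c -> /esym.
  apply: Or32; split=> //; last by case: (q.1.2) (p.1.2) => -[].
  case: x xb {Lt} => [c|] xb; last by case.
  by move=> /visE [_ cb]; apply: xb; rewrite cb.
Qed.

(** Membership is [List.In] because [Act] is a bare type without decidable equality. *)
Lemma weak_probe b L (p q : state (probe b L)) sigma : ~ List.In b sigma ->
  weak p sigma q -> weak p.1.1 sigma q.1.1.
Proof.
move=> nb [w + ew]; rewrite -ew in nb; move=> pq; exists w => //.
elim: w p nb pq {ew} => [|x w IH] p nb /=; first by move=> ->.
have xb : x <> Some b by move=> xb; apply: nb; rewrite xb; left.
case=> r /(probe_transP _ _ xb) pr /IH rq; exists r.1.1 => //; apply: rq.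
by case: x {xb pr} nb => //= c nb nw; apply: nb; right.
Qed.

Lemma probe_weak b L (s s' : state L) sigma : ~ List.In b sigma ->
  weak s sigma s' -> weak (L := probe b L) (s, tt, tt) sigma (s', tt, tt).
Proof.
move=> nb [w + ew]; rewrite -ew in nb; move=> pq; exists w => //.
elim: w s nb pq {ew} => [|x w IH] s nb /=; first by move=> ->.
have xb : x <> Some b by move=> xb; apply: nb; rewrite xb; left.
case=> r sr rs'; exists (r, tt, tt); first exact/probe_transP.
apply: IH rs'.
by case: x {xb sr} nb => //= c nb nw; apply: nb; right.
Qed.

(** A finite prefix of an infinite trace is a trace, and one avoiding [b] is due to [L] alone.
    Conversely, from whatever state [sigma] leads to, the outer loop supplies the infinite tail of
    [b]. *)
Lemma Inf_probe b L sigma : ~ List.In b sigma ->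
  Inf (probe b L) (cat_inf sigma (fun=> b)) <-> Tr L sigma.
Proof.
move=> nb; split.
- by move=> /weak_inf_prefix [t /(weak_probe nb)]; exists t.1.1.
- move=> [s /(probe_weak nb) Ls]; apply: weak_inf_cat Ls _.
  exists (fun=> Some b); last by exists id; split=> // k _; exists k.
  exists (fun=> (s, tt, tt)) => // _; apply: Or33; split=> //.
  by move=> /visE [[_ []]].
Qed.

Lemma exists_notin sigma : infinite_set [set: Act] ->
  exists b, ~ List.In b sigma.
Proof.
move=> infA; apply: contrapT => nex; apply: infA.
apply: (@sub_finite_set _ _ [set b | List.In b sigma]).
  by move=> b _; apply: contrapT => nb; apply: nex; exists b.
elim: sigma {nex} => [|a sigma IH]; first exact: finite_set0.
have -> : [set b | List.In b (a :: sigma)] =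
    [set a] `|` [set b | List.In b sigma].
  apply/seteqP; split=> b [->|]; by [left|right].
by rewrite finite_setU; split.
Qed.

End Contexts.

(** * Preservation of the alphabet and of traces, and the theorem *)

Lemma preserves_Inf_alphabet Act (R : lts Act -> lts Act -> Prop) :
  congruence R -> preserves R (@Inf Act) -> preserves R (@alphabet Act).
Proof.
move=> Rc RInf.
suff sub L L' : R L L' -> alphabet L `<=` alphabet L'.
  move=> L L' LL'; apply/seteqP; split; apply: sub => //.
  exact: (cong_sym Rc).
move=> LL' a La; apply: contrapT => nL'a.
(* The word a^omega travels from [par L' (loop a)] to [par L (loop a)] by congruence, then to [L]
   since [a] is in its alphabet, and back to [L']. *)
have : Inf L' (fun=> a).
  rewrite -(RInf _ _ LL'); apply: Inf_par_loop_in => //.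
  rewrite (RInf _ _ (cong_parl Rc (loop a) LL')).
  exact: Inf_par_loop_notin.
case=> w [p _ pw] [f [_ fa _]]; apply: nL'a.
by have := pw (f 0); rewrite fa; exact: trans_alphabet.
Qed.

Lemma preserves_Inf_Tr Act (R : lts Act -> lts Act -> Prop) :
  infinite_set [set: Act] -> congruence R -> preserves R (@Inf Act) ->
  preserves R (@Tr Act).
Proof.
move=> infA Rc RInf L L' LL'; apply/predeqP => sigma.
(* The context varies with the trace: each [sigma] gets its own fresh [b]. *)
have [b nb] := exists_notin sigma infA.
have RP : R (probe b L) (probe b L').
  by apply: (cong_parl Rc); apply: (cong_hide Rc); exact: (cong_parl Rc).
by rewrite -!(Inf_probe _ nb) (RInf _ _ RP).
Qed.

Unset Implicit Arguments.

Theorem theorem5p4 (Act : Type) (Act_infinite : infinite_set [set: Act])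
    (R : lts Act -> lts Act -> Prop) (R_congruence : congruence R)
    (R_cffd : forall L L' : lts Act, cffd_equiv L L' -> R L L')
    (R_Sf : preserves R (@Sf Act)) (R_Inf : preserves R (@Inf Act))
    (R_DB : R (D Act) (B Act)) :
  forall L L' : lts Act,
    R L L' <->
    [/\ alphabet L = alphabet L', Tr L = Tr L', Sf L = Sf L' &
        Inf L = Inf L'].
Proof.
move=> L L'; split.
  move=> LL'; split; [|exact: (@preserves_Inf_Tr _ R)|exact: R_Sf|exact: R_Inf].
  exact: (@preserves_Inf_alphabet _ R).
have R_parB N : R N (par N (B Act)).
  apply: (cong_trans R_congruence) (cong_parr R_congruence N R_DB).
  by apply: (cong_sym R_congruence); apply: R_cffd; exact: cffd_par_D.
case=> eA eT eS eI; apply: (cong_trans R_congruence (R_parB L)).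
apply: (cong_trans R_congruence) (cong_sym R_congruence (R_parB L')).
apply: R_cffd; split.
- by rewrite !alphabet_par_silent.
- by rewrite !Sf_par_B.
(* Divergences of the composites are the traces of [L] and [L'], so equality of [Tr] settles this
   component. *)
- by rewrite !Div_par_B.
- by rewrite !Inf_par_silent.
Qed.
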